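(* Let $A$ be a unital C$^*$-algebra and let $T:A\to A$ be a bounded linear map. Suppose that $T$ is a triple derivation at zero and $T(1)^*=-T(1)$. Then $T$ is a triple derivation.
   Context: For $a,b,c\in A$, $\{a,b,c\}=\frac12(ab^*c+cb^*a)$. A linear map $T:A\to A$ is a triple derivation at zero (also: triple derivable at zero) if $\{T(a),b,c\}+\{a,T(b),c\}+\{a,b,T(c)\}=0$ for all $a,b,c\in A$ with $\{a,b,c\}=0$. A triple derivation on $A$ is a linear map $\delta:A\to A$ with $\delta\{a,b,c\}=\{\delta(a),b,c\}+\{a,\delta(b),c\}+\{a,b,\delta(c)\}$ for all $a,b,c\in A$. *)

(* Defs.v *)
From HB Require Import structures.
From mathcomp Require Import all_boot all_order all_algebra.
From mathcomp Require Import complex.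
From mathcomp Require Import boolp classical_sets reals topology normedtype.

Set Implicit Arguments.
Unset Strict Implicit.
Unset Printing Implicit Defensive.

Import Order.TTheory GRing.Theory Num.Theory.
Import numFieldNormedType.Exports.

Local Open Scope ring_scope.
Local Open Scope complex_scope.

(* Unital complex C*-algebras: Banach spaces over R[i] with a product, a unit
   and an involution. Norms on a [completeNormedModType R[i]] take values in
   R[i], where 0 <= z forces z to be real. The product is a field of the mixin
   because Hierarchy Builder rejects a structure inheriting from both rings and
   normed modules ([numDomainType], declared earlier, would have to be a
   substructure of their missing join); every C*-algebra is made an [algType]
   right below, so that the usual ring notations and theory apply to it. *)
HB.mixin Record CompleteNormedModule_isCStarAlgebra (R : realType) A
    & CompleteNormedModule R[i] A := {
  cstar_one : A;
  cstar_mul : A -> A -> A;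
  star : A -> A;
  cstar_mulA : associative cstar_mul;
  cstar_mul1r : left_id cstar_one cstar_mul;
  cstar_mulr1 : right_id cstar_one cstar_mul;
  cstar_mulDl : left_distributive cstar_mul +%R;
  cstar_mulDr : right_distributive cstar_mul +%R;
  cstar_oner_neq0 : cstar_one != 0;
  cstar_scalerAl : forall (k : R[i]) (a b : A),
    k *: cstar_mul a b = cstar_mul (k *: a) b;
  cstar_scalerAr : forall (k : R[i]) (a b : A),
    k *: cstar_mul a b = cstar_mul a (k *: b);
  cstar_normM : forall a b : A, `|cstar_mul a b| <= `|a| * `|b|;
  starK : involutive star;
  starD : {morph star : a b / a + b};
  starZ : forall (k : R[i]) (a : A), star (k *: a) = (k^*)%R *: star a;
  cstar_starM : forall a b : A,
    star (cstar_mul a b) = cstar_mul (star b) (star a);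
  cstar_norm_starM : forall a : A, `|cstar_mul (star a) a| = `|a| ^+ 2
}.

#[short(type="cstarAlgType")]
HB.structure Definition CStarAlgebra (R : realType) :=
  {A of CompleteNormedModule R[i] A & CompleteNormedModule_isCStarAlgebra R A}.

#[non_forgetful_inheritance]
HB.instance Definition _ (R : realType) (A : cstarAlgType R) :=
  GRing.Zmodule_isNzRing.Build (CStarAlgebra.sort A)
    (@cstar_mulA R A) (@cstar_mul1r R A) (@cstar_mulr1 R A)
    (@cstar_mulDl R A) (@cstar_mulDr R A) (@cstar_oner_neq0 R A).
#[non_forgetful_inheritance]
HB.instance Definition _ (R : realType) (A : cstarAlgType R) :=
  GRing.LSemiModule_isLSemiAlgebra.Build R[i] (CStarAlgebra.sort A)
    (@cstar_scalerAl R A).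
#[non_forgetful_inheritance]
HB.instance Definition _ (R : realType) (A : cstarAlgType R) :=
  GRing.LSemiAlgebra_isSemiAlgebra.Build R[i] (CStarAlgebra.sort A)
    (@cstar_scalerAr R A).

Section CStarAlgebraTheory.
Context {R : realType} {A : cstarAlgType R}.
Implicit Types a b c : A.

Lemma cstar_normM_le a b : `|a * b| <= `|a| * `|b|.
Proof. exact: cstar_normM. Qed.

Lemma starM a b : star (a * b) = star b * star a.
Proof. exact: cstar_starM. Qed.

Lemma cstar_norm a : `|star a * a| = `|a| ^+ 2.
Proof. exact: cstar_norm_starM. Qed.

Definition triple a b c : A :=
  (2%:R : R[i])^-1 *: (a * star b * c + c * star b * a).

Definition bounded_operator (T : {linear A -> A}) : Prop :=
  exists M : R, forall a, `|T a| <= M%:C * `|a|.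

Definition triple_derivation (T : {linear A -> A}) : Prop :=
  forall a b c,
    T (triple a b c) = triple (T a) b c + triple a (T b) c + triple a b (T c).

Definition triple_derivation_at_zero (T : {linear A -> A}) : Prop :=
  forall a b c, triple a b c = 0 ->
    triple (T a) b c + triple a (T b) c + triple a b (T c) = 0.

End CStarAlgebraTheory.

(* Main.v *)
From HB Require Import structures.
Require Import Defs.
From mathcomp Require Import all_boot all_order all_algebra.
From mathcomp Require Import complex reals topology normedtype.
From mathcomp Require Import ring lra.
From mathcomp Require Import classical_sets.

Set Implicit Arguments.
Unset Strict Implicit.
Unset Printing Implicit Defensive.

Local Open Scope ring_scope.
Local Open Scope complex_scope.

Import Order.TTheory GRing.Theory Num.Theory.
Import numFieldNormedType.Exports.
Import sesquilinear.

(** Subtracting from T the inner triple derivation x |-> (h x + x h) / 2, where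
    h = T 1 is skew, one may assume T 1 = 0. It then suffices that T is a
    Jordan derivation commuting with the involution, because the triple product
    is a polynomial in the Jordan product and the involution
    ([jordan_star_triple_derivation]).

    Self-adjoint p, q with p q = 0 give many vanishing triple products: {p, 1, q}
    and all the {p, q, c}. The former yields that the bilinear map
    V(x, y) = T x y + y T x + x T y + T y x vanishes at (p, q). The latter yields
    that V'(x, y) = T x y + x S y does, where S x = T(x^* )^*: the obstruction
    T p q + p S q is central with square zero, and a C*-algebra has no such
    nonzero element.

    The key is that a bounded bilinear V vanishing at all such pairs satisfies
    V(k, k) = (V(k^2, 1) + V(1, k^2)) / 2 for self-adjoint k
    ([bilinear_orthogonal]). Let D(k) be the difference of the two sides, a
    quadratic form whose polar form vanishes at (k, 1). As |k| + k and |k| - k are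
    orthogonal, D(|k|) = D(k), so that the tent map m = 2 |k| - 1 satisfies
    D(m) = 4 D(k). It preserves the unit ball, where D is bounded, so iterating it
    gives D(k) = 0. Absolute values come from the elementary iteration for square
    roots ([exists_sqrt]) and from the bound ||1 - 2 h^2|| <= 1 for self-adjoint
    contractions h: 1 - 2 h^2 is the real part of the square of the unitary
    sqrt(1 - h^2) + i h.

    Applied to V this makes T a Jordan derivation. Applied to V', it shows that
    E = T - S satisfies E(xy + yx) = 2 (x E y + y E x). Since E is moreover
    skew on self-adjoint elements, its values on |k| + k and |k| - k are
    orthogonal, so ||E |k| || = ||E k||, and the same tent map argument gives
    E = 0 ([sa_skew_quasiderivation_eq0]), that is, T = S. *)

(** * Normalisation of noncommutative polynomial identities *)

Module NCPoly.

Inductive expr :=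
  Var of nat | Zero | One | Add of expr & expr | Opp of expr | Mul of expr & expr.

Definition monomial := (int * seq nat)%type.

(** Adds a monomial, dropping it when its coefficient cancels, so that the zero
    polynomial has the empty list as its only normal form. *)
Fixpoint insert (m : monomial) (p : seq monomial) : seq monomial :=
  if p is m' :: p' then
    if m.2 == m'.2 then
      if m.1 + m'.1 == 0 then p' else (m.1 + m'.1, m.2) :: p'
    else m' :: insert m p'
  else [:: m].

Definition add (p q : seq monomial) := foldr insert q p.

Definition scale (m : monomial) (p : seq monomial) :=
  [seq (m.1 * m'.1, m.2 ++ m'.2) | m' <- p].

Fixpoint norm e : seq monomial :=
  match e with
  | Var n => [:: (1, [:: n])]
  | Zero => [::]
  | One => [:: (1, [::])]
  | Add e1 e2 => add (norm e1) (norm e2)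
  | Opp e1 => scale (-1, [::]) (norm e1)
  | Mul e1 e2 => let q := norm e2 in foldr (fun m => add (scale m q)) [::] (norm e1)
  end.

Section Correctness.
Variables (B : nzRingType) (env : seq B).

Fixpoint eval e : B :=
  match e with
  | Var n => nth 0 env n
  | Zero => 0
  | One => 1
  | Add e1 e2 => eval e1 + eval e2
  | Opp e1 => - eval e1
  | Mul e1 e2 => eval e1 * eval e2
  end.

Definition eval_monomial (m : monomial) : B :=
  (\prod_(i <- m.2) nth 0 env i) *~ m.1.

Definition eval_norm p : B := \sum_(m <- p) eval_monomial m.

Lemma eval_insert m p : eval_norm (insert m p) = eval_monomial m + eval_norm p.
Proof.
elim: p => [|m' p IHp] /=; first by rewrite /eval_norm !big_seq1 big_nil addr0.
have [eq_w|_] := eqVneq; last by rewrite /eval_norm !big_cons -!/(eval_norm _) IHp addrCA.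
have eqm : eval_monomial m + eval_monomial m' = eval_monomial (m.1 + m'.1, m.2).
  by rewrite /eval_monomial -eq_w mulrzDr.
rewrite {2}/eval_norm big_cons -/(eval_norm _) addrA eqm.
have [->|_] := eqVneq; first by rewrite /eval_monomial mulr0z add0r.
by rewrite /eval_norm big_cons.
Qed.

Lemma eval_add p q : eval_norm (add p q) = eval_norm p + eval_norm q.
Proof.
elim: p => [|m p IHp] /=; first by rewrite {2}/eval_norm big_nil add0r.
by rewrite eval_insert IHp addrA [in RHS]/eval_norm big_cons.
Qed.

Lemma eval_scale m p : eval_norm (scale m p) = eval_monomial m * eval_norm p.
Proof.
rewrite /eval_norm big_map mulr_sumr; apply: eq_bigr => m' _.
by rewrite /eval_monomial big_cat /= mulrzAl mulrzAr mulrzA_C mulrzA.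
Qed.

Lemma eval_normE e : eval_norm (norm e) = eval e.
Proof.
elim: e => [n|||e1 IH1 e2 IH2|e1 IH1|e1 IH1 e2 IH2] /=.
- by rewrite /eval_norm big_seq1 /eval_monomial big_seq1 mulr1z.
- by rewrite /eval_norm big_nil.
- by rewrite /eval_norm big_seq1 /eval_monomial big_nil mulr1z.
- by rewrite eval_add IH1 IH2.
- by rewrite eval_scale IH1 /eval_monomial big_nil mulrN1z mulN1r.
rewrite -IH1; elim: (norm e1) => [|m p IHp] /=.
  by rewrite /eval_norm !big_nil mul0r.
by rewrite eval_add eval_scale IHp IH2 -mulrDl [in RHS]/eval_norm big_cons.
Qed.

Lemma eqP e1 e2 : nilp (norm (Add e1 (Opp e2))) -> eval e1 = eval e2.
Proof.
move=> /nilP e0; apply/eqP; rewrite -subr_eq0.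
by rewrite -[_ - _]/(eval (Add e1 (Opp e2))) -eval_normE e0 /eval_norm big_nil.
Qed.

End Correctness.

Ltac index x env :=
  match env with
  | ?y :: ?env' =>
    match constr:(Set) with
    | _ => let _ := match constr:(Set) with _ => unify x y end in constr:(0%N)
    | _ => let n := index x env' in constr:(S n)
    end
  end.

Ltac add_var x env :=
  match constr:(Set) with
  | _ => let n := index x env in constr:((env, n))
  | _ => let env' := eval cbv [rcons] in (rcons env x) in
         let n := index x env' in constr:((env', n))
  end.

Ltac reify x env :=
  lazymatch x with
  | GRing.add ?a ?b =>
    lazymatch reify a env with (?env1, ?e1) =>
    lazymatch reify b env1 with (?env2, ?e2) => constr:((env2, Add e1 e2)) end end
  | GRing.mul ?a ?b =>
    lazymatch reify a env with (?env1, ?e1) =>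
    lazymatch reify b env1 with (?env2, ?e2) => constr:((env2, Mul e1 e2)) end end
  | GRing.opp ?a =>
    lazymatch reify a env with (?env1, ?e1) => constr:((env1, Opp e1)) end
  | @GRing.zero _ => constr:((env, Zero))
  | @GRing.one _ => constr:((env, One))
  | _ => lazymatch add_var x env with (?env1, ?n) => constr:((env1, Var n)) end
  end.

End NCPoly.

(** Decides the identities that hold in every noncommutative ring; maximal
    subterms that are not sums, opposites, products, 0 or 1 are atoms. *)
Ltac nc_ring :=
  lazymatch goal with
  | |- @eq ?T ?x ?y =>
    lazymatch NCPoly.reify x (@nil T) with (?env1, ?e1) =>
    lazymatch NCPoly.reify y env1 with (?env2, ?e2) =>
      apply: (@NCPoly.eqP _ env2 e1 e2); vm_compute; reflexivity end end
  end.

(** * The norm as a real number, and self-adjoint elements *)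

Section Norm.
Context {R : realType} {A : cstarAlgType R}.
Implicit Types a b c x y : A.

(** Norms live in R[i], which is only partially ordered; the real part moves
    them to R, where inequalities are decided by real arithmetic. *)
Definition nrm a : R := complex.Re `|a|.

Lemma nrmE a : `|a| = (nrm a)%:C.
Proof. by rewrite /nrm RRe_real // normr_real. Qed.

Lemma nrm_ge0 a : 0 <= nrm a.
Proof. by rewrite -ler0c -nrmE. Qed.

Lemma nrm0 : nrm 0 = 0.
Proof. by rewrite /nrm normr0. Qed.

Lemma nrm_eq0 a : nrm a = 0 -> a = 0.
Proof. by move=> a0; apply/eqP; rewrite -normr_eq0 nrmE a0. Qed.

Lemma nrmN a : nrm (- a) = nrm a.
Proof. by rewrite /nrm normrN. Qed.

Lemma nrmD a b : nrm (a + b) <= nrm a + nrm b.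
Proof. by rewrite -lecR rmorphD /= -!nrmE ler_normD. Qed.

Lemma nrmB a b : nrm (a - b) <= nrm a + nrm b.
Proof. by rewrite -(nrmN b) nrmD. Qed.

Lemma nrmM a b : nrm (a * b) <= nrm a * nrm b.
Proof. by rewrite -lecR rmorphM /= -!nrmE cstar_normM_le. Qed.

Lemma nrmZ (k : R) a : nrm (k%:C *: a) = `|k| * nrm a.
Proof.
apply: complexI; rewrite rmorphM /= -!nrmE normrZ; congr (_ * _).
by rewrite normc_def /= expr0n /= addr0 sqrtr_sqr.
Qed.

Lemma nrm_starM a : nrm (star a * a) = nrm a ^+ 2.
Proof. by apply: complexI; rewrite rmorphXn /= -!nrmE cstar_norm. Qed.

Lemma starM_eq0 a : star a * a = 0 -> a = 0.
Proof.
move=> a0; apply: nrm_eq0; apply/eqP; rewrite -(sqrf_eq0 (nrm a)).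
by rewrite -nrm_starM a0 nrm0.
Qed.

Lemma star0 : star 0 = 0 :> A.
Proof. by apply: (addrI (star 0)); rewrite -starD !addr0. Qed.

Lemma starN a : star (- a) = - star a.
Proof. by apply: (addrI (star a)); rewrite -starD !subrr star0. Qed.

Lemma starB a b : star (a - b) = star a - star b.
Proof. by rewrite starD starN. Qed.

Lemma star1 : star 1 = 1 :> A.
Proof. by rewrite -[LHS]mul1r -{1}(starK (1 : A)) -starM mul1r starK. Qed.

Lemma nrm_star_le a : nrm a <= nrm (star a).
Proof.
have [->|a0] := eqVneq a 0; first by rewrite star0.
have a_gt0 : 0 < nrm a.
  by rewrite lt_def nrm_ge0 andbT; apply: contraNneq a0 => /nrm_eq0 ->.
by rewrite -(ler_pM2r a_gt0) -expr2 -nrm_starM nrmM.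
Qed.

Lemma nrm_star a : nrm (star a) = nrm a.
Proof. by apply/eqP; rewrite eq_le nrm_star_le -{2}(starK a) nrm_star_le. Qed.

Lemma nrm1 : nrm (1 : A) = 1.
Proof.
have := nrm_starM (1 : A); rewrite star1 mul1r expr2.
have [/nrm_eq0/eqP|n0] := eqVneq (nrm (1 : A)) 0; first by rewrite oner_eq0.
by rewrite -[LHS]mul1r => /(mulIf n0).
Qed.

Lemma conjC_real (k : R) : (k%:C^*)%R = k%:C :> R[i].
Proof. by rewrite conj_Creal //; apply/complex_realP; exists k. Qed.

Lemma starZr (k : R) a : star (k%:C *: a) = k%:C *: star a.
Proof. by rewrite starZ conjC_real. Qed.

Lemma starZi a : star ('i *: a) = - ('i *: star a).
Proof. by rewrite starZ -scaleNr conjCi. Qed.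

Definition sa a := star a = a.

Lemma sa1 : sa (1 : A). Proof. exact: star1. Qed.
Lemma saD a b : sa a -> sa b -> sa (a + b).
Proof. by rewrite /sa starD => -> ->. Qed.
Lemma saB a b : sa a -> sa b -> sa (a - b).
Proof. by rewrite /sa starB => -> ->. Qed.
Lemma saZ (k : R) a : sa a -> sa (k%:C *: a).
Proof. by rewrite /sa starZr => ->. Qed.
Lemma saM a b : sa a -> sa b -> a * b = b * a -> sa (a * b).
Proof. by rewrite /sa starM => -> -> ->. Qed.
Lemma saX a : sa a -> sa (a * a).
Proof. by move=> sa_a; apply: saM. Qed.

Lemma nrm_sqr a : sa a -> nrm (a * a) = nrm a ^+ 2.
Proof. by move=> sa_a; rewrite -nrm_starM sa_a. Qed.

Lemma scaler_eq0_cancel (k : R[i]) a : k != 0 -> k *: a = 0 -> a = 0.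
Proof. by move=> k0 /eqP; rewrite scaler_eq0 (negPf k0) => /eqP. Qed.

Lemma addrr_eq0 a : a + a = 0 -> a = 0.
Proof.
rewrite -mulr2n -scaler_nat => /scaler_eq0_cancel; apply.
by rewrite pnatr_eq0.
Qed.

Lemma addrr_inj a b : a + a = b + b -> a = b.
Proof.
move=> ab; apply/eqP; rewrite -subr_eq0; apply/eqP/addrr_eq0.
by rewrite addrACA -opprD ab subrr.
Qed.

(** Every element is a complex combination of two self-adjoint ones. The map is
    unbundled so that the lemma applies to expressions linear in one variable. *)
Lemma linear_sa_eq0 (f : A -> A) :
    (forall k : R[i], {morph f : a / k *: a}) -> {morph f : a b / a + b} ->
  (forall a, sa a -> f a = 0) -> forall a, f a = 0.
Proof.
move=> fZ fD f0 a.
have e1 : f a + f (star a) = 0.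
  by rewrite -fD f0 // /sa starD starK addrC.
have e2 : f a - f (star a) = 0.
  have /(scaler_eq0_cancel (neq0Ci _)) : 'i *: f (a - star a) = 0.
    by rewrite -fZ f0 // /sa starZi starB starK -scalerN opprB.
  by rewrite -scaleN1r fD fZ scaleN1r.
apply: addrr_eq0; rewrite -[RHS]addr0 -{1}e1 -e2; nc_ring.
Qed.

End Norm.

(** * Square roots *)

Section Sqrt.
Context {R : realType} {A : cstarAlgType R}.
Implicit Types a b c x y : A.

Lemma nrm_small_eq0 (C : R) a : (forall e, 0 < e -> nrm a <= C * e) -> a = 0.
Proof.
move=> small; apply: nrm_eq0; apply/eqP; rewrite eq_le nrm_ge0 andbT.
apply/ler_addgt0Pl => e e0; rewrite addr0.
have C1 : 0 < `|C| + 1 by rewrite ltr_pwDr.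
apply: (le_trans (small (e / (`|C| + 1)) (divr_gt0 e0 C1))).
rewrite mulrA ler_pdivrMr // mulrC ler_pM2l //.
by rewrite (le_trans (ler_norm C)) // lerDl.
Qed.

Lemma nrm_complete (y : nat -> A) :
  (forall e : R, 0 < e -> exists N, forall n, (N <= n)%N -> nrm (y N - y n) < e) ->
  exists l, forall e : R, 0 < e -> exists N, forall n, (N <= n)%N -> nrm (l - y n) < e.
Proof.
move=> y_cauchy.
have y_cvg : cvg (y @ \oo)%classic.
  apply/cauchy_cvgP/cauchyP => e e0.
  have e0' : 0 < complex.Re e by rewrite -ltcR RRe_real // gtr0_real.
  have [N yN] := y_cauchy _ e0'.
  exists (y N); exists N => // n /= Nn.
  rewrite /= -ball_normE /= nrmE.
  by rewrite -[e]RRe_real ?gtr0_real // ltcR yN.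
have [l y_l] : exists l : A, (y @ \oo --> l)%classic by move: y_cvg; rewrite cvg_ex.
exists l => e e0.
have /cvgrPdist_lt/(_ e%:C) := y_l.
rewrite (ltcR 0) => /(_ e0) [N _ yN]; exists N => n Nn.
by rewrite -ltcR -nrmE yN.
Qed.

Lemma nrm_double a : nrm (a + a) = nrm a *+ 2.
Proof.
have -> : a + a = 2%:C *: a by rewrite -mulr2n -scaler_nat rmorph_nat.
by rewrite nrmZ ger0_norm // mulr_natl.
Qed.

Definition halve a : A := 2^-1%:C *: a.

Lemma halveK a : halve a + halve a = a.
Proof. by rewrite /halve -scalerDl -rmorphD /= (_ : 2^-1 + 2^-1 = 1) ?scale1r //; field. Qed.

Lemma halve_double a : halve (a + a) = a.
Proof. by rewrite /halve scalerDr halveK. Qed.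

(** Iteration for 1 - sqrt(1 - x): its limit y satisfies
    2 y = x + y^2, that is, (1 - y)^2 = 1 - x. *)
Fixpoint sqrt_iter x n : A :=
  if n is m.+1 then halve (x + sqrt_iter x m * sqrt_iter x m) else 0.

(** The same iteration at x = 1. As the iterates are polynomials in x with
    nonnegative coefficients, it dominates them in norm, increments included. *)
Fixpoint sqrt_bound n : R :=
  if n is m.+1 then (1 + sqrt_bound m * sqrt_bound m) / 2 else 0.

Lemma sqrt_bound_ge0 n : 0 <= sqrt_bound n.
Proof. by elim: n => //= n IHn; rewrite divr_ge0 // addr_ge0 // mulr_ge0. Qed.

Lemma sqrt_bound_le1 n : sqrt_bound n <= 1.
Proof. elim: n => [|n IHn] /=; [exact: ler01 | by have := sqrt_bound_ge0 n; nra]. Qed.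

(** With d = 1 - t, one step sends d to d - d^2 / 2, which increases on [0, 1]
    and sends 2 / (n + 2) below 2 / (n + 3). *)
Lemma sqrt_bound_rate n : 1 - sqrt_bound n <= 2 / n.+2%:R.
Proof.
elim: n => [|n IHn] /=; first by lra.
have t0 := sqrt_bound_ge0 n; have t1 := sqrt_bound_le1 n.
set t := sqrt_bound n in IHn t0 t1 *.
rewrite ler_pdivlMr ?ltr0n // in IHn; rewrite ler_pdivlMr ?ltr0n //.
move: IHn; rewrite -(natr1 n.+2); set N := n.+2%:R => IHn.
have N2 : 2 <= N by rewrite ler_nat.
have : 0 <= N by lra.
nra.
Qed.

Section Iteration.
Variable x : A.
Hypothesis x_le1 : nrm x <= 1.
Let y := sqrt_iter x.
Let t := sqrt_bound.

Let yS n : y n.+1 + y n.+1 = x + y n * y n. Proof. exact: halveK. Qed.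

Lemma sqrt_iter_le n : nrm (y n) <= t n.
Proof.
elim: n => [|n IHn]; first by rewrite nrm0.
have := nrmD x (y n * y n); rewrite -yS nrm_double /t /= -/t.
have := nrmM (y n) (y n).
have : nrm (y n) * nrm (y n) <= t n * t n by rewrite ler_pM ?nrm_ge0.
move: x_le1; rewrite mulr2n; lra.
Qed.

Lemma sqrt_iter_step n : nrm (y n.+1 - y n) <= t n.+1 - t n.
Proof.
elim: n => [|n IHn].
  have -> : y 1 - y 0 = y 1 by exact: subr0.
  have := nrm_double (y 1); rewrite yS {1}[y 0]/= mulr0 addr0 /t /= mulr2n.
  by move: x_le1; lra.
have := nrm_double (y n.+2 - y n.+1).
have -> : y n.+2 - y n.+1 + (y n.+2 - y n.+1)
    = (y n.+1 - y n) * y n.+1 + y n * (y n.+1 - y n).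
  rewrite addrACA -opprD !yS; nc_ring.
move: (nrmD ((y n.+1 - y n) * y n.+1) (y n * (y n.+1 - y n))) => le_sum eq2.
have le1 : nrm ((y n.+1 - y n) * y n.+1) <= (t n.+1 - t n) * t n.+1.
  by apply: le_trans (nrmM _ _) _; rewrite ler_pM ?nrm_ge0 ?sqrt_iter_le.
have le2 : nrm (y n * (y n.+1 - y n)) <= t n * (t n.+1 - t n).
  by apply: le_trans (nrmM _ _) _; rewrite ler_pM ?nrm_ge0 ?sqrt_iter_le.
have tS m : t m.+1 = (1 + t m * t m) / 2 by [].
have := tS n; rewrite (tS n.+1); nra.
Qed.

Lemma sqrt_iter_dist n k : nrm (y n - y (n + k)%N) <= t (n + k)%N - t n.
Proof.
elim: k => [|k IHk]; first by rewrite addn0 !subrr nrm0.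
rewrite addnS -(subrK (y (n + k)%N) (y n)) -addrA.
apply: le_trans (nrmD _ _) _.
have := sqrt_iter_step (n + k); rewrite -nrmN opprB; move: IHk; lra.
Qed.

Lemma sqrt_iter_cvg : exists l, forall e : R, 0 < e ->
  exists n, nrm (l - y n) < e /\ nrm (l - y n.+1) < e.
Proof.
have [e e0|l yl] := @nrm_complete y.
  exists (Num.bound (2 / e)) => n /subnKC <-.
  apply: le_lt_trans (sqrt_iter_dist _ _) _.
  have := sqrt_bound_rate (Num.bound (2 / e)).
  have /archi_boundP : 0 <= 2 / e by rewrite divr_ge0 // ltW.
  set N := Num.bound _ => ltN rate.
  apply: (@le_lt_trans _ _ (2 / N.+2%:R)).
    by apply: le_trans rate; rewrite lerB // sqrt_bound_le1.
  rewrite ltr_pdivrMr // mulrC -ltr_pdivrMr //.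
  by apply: lt_le_trans ltN _; rewrite ler_nat ltnW.
exists l => e /yl [N lN]; exists N; split; apply: lN => //.
Qed.

Lemma sqrt_iter_comm c n : c * x = x * c -> c * y n = y n * c.
Proof.
move=> cx; elim: n => [|n IHn]; first by rewrite mulr0 mul0r.
rewrite /y /= /halve -scalerAr -scalerAl -!/(y _) mulrDr mulrDl cx.
by rewrite mulrA IHn -!mulrA IHn.
Qed.

Lemma sqrt_iter_sa n : sa x -> sa (y n).
Proof.
move=> sa_x; elim: n => [|n IHn]; first exact: star0.
by rewrite /y /=; apply: saZ; apply: saD => //; apply: saX.
Qed.

End Iteration.

(** The last two clauses hold because r is a limit of real polynomials in x. *)
Lemma exists_sqrt x : nrm x <= 1 ->
  exists r, [/\ r * r = 1 - x, nrm (1 - r) <= 1,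
    forall c, c * x = x * c -> c * r = r * c & sa x -> sa r].
Proof.
move=> x_le1; have [l yl] := sqrt_iter_cvg x_le1.
have l_le1 : nrm l <= 1.
  apply/ler_addgt0Pl => e /yl [n [ln _]].
  rewrite -(subrK (sqrt_iter x n) l); apply: le_trans (nrmD _ _) _.
  have := sqrt_iter_le x_le1 n; have := sqrt_bound_le1 n; lra.
exists (1 - l); split=> [||c cx|sa_x]; [|by rewrite subKr| |].
- have : l + l - (x + l * l) = 0.
    apply: (@nrm_small_eq0 4) => e /yl [n [ln lSn]].
    set z := sqrt_iter x n in ln; have z_le1 : nrm z <= 1.
      by apply: le_trans (sqrt_iter_le x_le1 n) (sqrt_bound_le1 n).
    have -> : l + l - (x + l * l) = (l - sqrt_iter x n.+1) + (l - sqrt_iter x n.+1)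
        - ((l - z) * l + z * (l - z)).
      have := halveK (x + z * z); rewrite -[halve _]/(sqrt_iter x n.+1) => zS.
      rewrite addrACA -opprD zS; nc_ring.
    have := nrmB (l - sqrt_iter x n.+1 + (l - sqrt_iter x n.+1))
                 ((l - z) * l + z * (l - z)).
    have := nrmD ((l - z) * l) (z * (l - z)); rewrite nrm_double mulr2n.
    have := nrmM (l - z) l; have := nrmM z (l - z).
    have : nrm (l - z) * nrm l <= e * 1 by rewrite ler_pM ?nrm_ge0 // ltW.
    have : nrm z * nrm (l - z) <= 1 * e by rewrite ler_pM ?nrm_ge0 // ltW.
    move: lSn; lra.
  move=> /eqP; rewrite subr_eq0 => /eqP eql.
  have -> : (1 - l) * (1 - l) = 1 - (l + l) + l * l by nc_ring.
  rewrite eql; nc_ring.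
- suff : c * l - l * c = 0.
    move=> /eqP; rewrite subr_eq0 => /eqP eql.
    by rewrite mulrBr mulrBl mulr1 mul1r eql.
  apply: (@nrm_small_eq0 (nrm c + nrm c)) => e /yl [n [ln _]].
  have -> : c * l - l * c = c * (l - sqrt_iter x n) - (l - sqrt_iter x n) * c.
    rewrite mulrBr mulrBl (sqrt_iter_comm n cx); nc_ring.
  apply: le_trans (nrmB _ _) _; rewrite [leRHS]mulrDl.
  apply: lerD; apply: le_trans (nrmM _ _) _; last rewrite mulrC;
    by rewrite ler_wpM2l ?nrm_ge0 // ltW.
- suff /eqP : star l - l = 0.
    by rewrite subr_eq0 => /eqP eql; rewrite /sa starB star1 eql.
  apply: (@nrm_small_eq0 2) => e /yl [n [ln _]].
  have -> : star l - l = star (l - sqrt_iter x n) - (l - sqrt_iter x n).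
    rewrite starB (sqrt_iter_sa n sa_x); nc_ring.
  apply: le_trans (nrmB _ _) _; rewrite nrm_star; move: ln; lra.
Qed.

(** If r^2 = 1 - h^2 then u = r + i h is unitary and 1 - 2 h^2 is the real part
    of u^2. *)
Lemma nrm_1B2sqr h : sa h -> nrm h <= 1 -> nrm ((1 : A) - (h * h + h * h)) <= 1.
Proof.
move=> sa_h h_le1.
have [|r [rr _ rc rsa]] := @exists_sqrt (h * h).
  by rewrite nrm_sqr // expr_le1 // nrm_ge0.
have hr : h * r = r * h by apply: rc; rewrite mulrA.
have {}rsa : sa r := rsa (saX sa_h).
set k := 'i *: h.
have star_k : star k = - k by rewrite starZi sa_h.
have kk : k * k = - (h * h).
  by rewrite -scalerAl -scalerAr scalerA -expr2 sqrCi scaleN1r.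
have kr : k * r = r * k by rewrite -scalerAl hr scalerAr.
set u := r + k; set v := r - k.
have star_u : star u = v by rewrite starD star_k rsa.
have vu : v * u = 1.
  have -> : v * u = r * r - k * k + (r * k - k * r) by rewrite /u /v; nc_ring.
  rewrite kr rr kk; nc_ring.
have nrm_u : nrm u = 1.
  have := nrm_starM u; rewrite star_u vu nrm1 => /esym/eqP.
  by rewrite sqrp_eq1 ?nrm_ge0 // => /eqP.
have nrm_v : nrm v = 1 by rewrite -star_u nrm_star.
have e : (1 : A) - (h * h + h * h) + (1 - (h * h + h * h)) = u * u + v * v.
  have -> : u * u + v * v = r * r + k * k + (r * r + k * k) by rewrite /u /v; nc_ring.
  rewrite rr kk; nc_ring.
have := nrm_double (1 - (h * h + h * h)); rewrite e mulr2n.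
have := nrmD (u * u) (v * v); have := nrmM u u; have := nrmM v v.
rewrite nrm_u nrm_v; lra.
Qed.

Lemma nrm_1Bsqr h : sa h -> nrm h <= 1 -> nrm ((1 : A) - h * h) <= 1.
Proof.
move=> sa_h h_le1; have := nrm_1B2sqr sa_h h_le1.
have := nrm_double (1 - h * h).
have -> : 1 - h * h + (1 - h * h) = 1 + (1 - (h * h + h * h)) by nc_ring.
have := nrmD 1 (1 - (h * h + h * h)); rewrite nrm1 mulr2n; lra.
Qed.

(** The element a is the absolute value of k. The last bound, which says that
    its spectrum lies in [0, 1], is [nrm_1B2sqr] at the square root of a. *)
Lemma exists_abs k : sa k -> nrm k <= 1 ->
  exists a, [/\ sa a, a * a = k * k, a * k = k * a & nrm (a + a - 1) <= 1].
Proof.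
move=> sa_k k_le1.
have [a [aa a_le1 ac asa]] := exists_sqrt (nrm_1Bsqr sa_k k_le1).
have {}asa : sa a by apply: asa; apply: saB (saX sa_k); apply: sa1.
have {}aa : a * a = k * k by rewrite aa; nc_ring.
have ak : a * k = k * a by rewrite ac //; nc_ring.
exists a; split=> //.
(* The bound ||1 - a|| <= 1 makes a = 1 - (1 - a) a square again. *)
have [s [ss _ _ ssa]] := exists_sqrt a_le1.
have {}ssa : sa s by apply: ssa; apply: saB asa; apply: sa1.
have {}ss : s * s = a by rewrite ss; nc_ring.
have a_le : nrm a <= 1.
  by rewrite -(@expr_le1 _ 2) ?nrm_ge0 // -nrm_sqr // aa nrm_sqr // expr_le1 ?nrm_ge0.
rewrite -nrmN opprB -ss; apply: nrm_1B2sqr => //.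
by rewrite -(@expr_le1 _ 2) ?nrm_ge0 // -nrm_sqr // ss.
Qed.

End Sqrt.

(** * Bilinear maps vanishing on orthogonal pairs *)

Section Orthogonality.
Context {R : realType} {A : cstarAlgType R}.
Implicit Types a b c k x y : A.

(** Iterating k |-> m stays in the unit ball and at least doubles f each time,
    which no positive value of a bounded f survives. *)
Lemma doubling_le0 (f : A -> R) (C : R) :
    (forall k, sa k -> nrm k <= 1 -> f k <= C) ->
    (forall k, sa k -> nrm k <= 1 ->
       exists m, [/\ sa m, nrm m <= 1 & f k *+ 2 <= f m]) ->
  forall k, sa k -> nrm k <= 1 -> f k <= 0.
Proof.
move=> f_le f_double.
have pow n : forall k, sa k -> nrm k <= 1 -> f k *+ 2 ^ n <= C.
  elim: n => [|n IHn] k sa_k k_le1; first exact: f_le.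
  have [m [sa_m m_le1 le_m]] := f_double k sa_k k_le1.
  by apply: le_trans (IHn m sa_m m_le1); rewrite expnS mulrnA lerMn2r le_m orbT.
move=> k sa_k k_le1; rewrite leNgt; apply/negP => fk_gt0.
have C_ge0 : 0 <= C by rewrite (le_trans (ltW fk_gt0)) // f_le.
have /archi_boundP : 0 <= C / f k by rewrite divr_ge0 // ltW.
set N := Num.bound _; rewrite ltr_pdivrMr // mulr_natl ltNge => /negP; apply.
apply: le_trans (pow N k sa_k k_le1).
by rewrite ler_wpMn2l ?(ltW fk_gt0) // ltnW // ltn_expl.
Qed.

Lemma sa_scale_unit a : sa a -> exists (s : R) k, [/\ a = s%:C *: k, sa k & nrm k <= 1].
Proof.
move=> sa_a; have s_gt0 : 0 < nrm a + 1 by rewrite ltr_wpDl ?nrm_ge0.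
exists (nrm a + 1), ((nrm a + 1)^-1%:C *: a); split; last 1 first.
- rewrite nrmZ gtr0_norm ?invr_gt0 // mulrC ler_pdivrMr // mul1r lerDl //.
- by rewrite scalerA -rmorphM /= mulfV ?gt_eqF // scale1r.
- exact: saZ.
Qed.

Variable V : {bilinear A -> A -> A}.

Let defect x y :=
  V x y + V x y + (V y x + V y x) - (V (x * y + y * x) 1 + V 1 (x * y + y * x)).

(** The defect below is a symmetric bilinear form vanishing at (x, 1) and at
    orthogonal pairs; these two properties make its diagonal grow fourfold under
    the tent map k |-> 2 |k| - 1. *)
Lemma bilinear_orthogonal (C : R) :
    (forall x y, nrm x <= 1 -> nrm y <= 1 -> nrm (V x y) <= C) ->
    (forall p q, sa p -> sa q -> p * q = 0 -> V p q = 0) ->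
  forall x y, V x y + V x y + (V y x + V y x)
    = V (x * y + y * x) 1 + V 1 (x * y + y * x).
Proof.
move=> V_le V_orth.
have defectDl y : {morph defect^~ y : a b / a + b}.
  move=> a b; rewrite /defect !mulrDl !mulrDr !linearDl !linearDr /=; nc_ring.
have defectC x y : defect x y = defect y x.
  by rewrite /defect addrC [y * x + _]addrC addrC; congr (_ + _); rewrite addrC.
have defectZl y (k : R[i]) : {morph defect^~ y : a / k *: a}.
  move=> a; rewrite /defect -!scalerAl -!scalerAr -scalerDr.
  by rewrite !linearZl_LR !linearZr_LR /= -!scalerDr -scalerBr.
have defectBl y a b : defect (a - b) y = defect a y - defect b y.
  by rewrite defectDl -scaleN1r defectZl scaleN1r.
have defectDr x a b : defect x (a + b) = defect x a + defect x b.
  by rewrite !(defectC x) defectDl.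
have defectBr x a b : defect x (a - b) = defect x a - defect x b.
  by rewrite !(defectC x) defectBl.
have defect1 x : defect x 1 = 0.
  rewrite /defect mulr1 mul1r linearDl linearDr /=; nc_ring.
have defect_orth p q : sa p -> sa q -> p * q = 0 -> defect p q = 0.
  move=> sa_p sa_q pq; have qp : q * p = 0 by rewrite -sa_p -sa_q -starM pq star0.
  by rewrite /defect pq qp (V_orth p q) ?(V_orth q p) // !addr0 linear0l linear0r addr0 subr0.
have defect_bound k : sa k -> nrm k <= 1 -> nrm (defect k k) <= C *+ 8.
  move=> _ k_le1; have kk : nrm (k * k) <= 1.
    by apply: le_trans (nrmM _ _) _; rewrite mulr_ile1 ?nrm_ge0.
  rewrite /defect linearDl linearDr /=.
  have v1 := V_le k k k_le1 k_le1.
  have v2 := V_le (k * k) 1 kk; rewrite nrm1 in v2; have {}v2 := v2 (lexx _).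
  have v3 := V_le 1 (k * k); rewrite nrm1 in v3; have {}v3 := v3 (lexx _) kk.
  set u := V k k in v1 *; set v := V _ 1 in v2 *; set w := V 1 _ in v3 *.
  apply: le_trans (nrmB _ _) _; rewrite nrm_double.
  have := nrm_double u; have := nrmD (v + v) (w + w); rewrite !nrm_double.
  rewrite !mulrS !mulr0n; lra.
have defect_double k : sa k -> nrm k <= 1 ->
    exists m, [/\ sa m, nrm m <= 1 & nrm (defect k k) *+ 2 <= nrm (defect m m)].
  move=> sa_k k_le1; have [a [sa_a aa ak m_le1]] := exists_abs sa_k k_le1.
  exists (a + a - 1); split=> //; first by apply: saB (saD sa_a sa_a) sa1.
  have defect_ak : defect a a = defect k k.
    apply/eqP; rewrite -subr_eq0; apply/eqP.
    have <- : defect (a + k) (a - k) = 0.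
      apply: defect_orth; [exact: saD|exact: saB|].
      by rewrite mulrDl !mulrBr aa ak; nc_ring.
    rewrite defectDl !defectBr (defectC k a); nc_ring.
  rewrite -defect_ak defectBr defect1 subr0 defectBl (defectC 1) defect1 subr0.
  rewrite defectDl defectDr; set d := defect a a.
  by rewrite !nrm_double [leRHS]mulr2n lerDl mulrn_wge0 // nrm_ge0.
have defect_unit k : sa k -> nrm k <= 1 -> defect k k = 0.
  move=> sa_k k_le1; apply: nrm_eq0; apply/eqP; rewrite eq_le nrm_ge0 andbT.
  exact: (doubling_le0 defect_bound defect_double).
have defect_sqr a : sa a -> defect a a = 0.
  move=> /sa_scale_unit [s [k [-> sa_k k_le1]]].
  by rewrite defectZl defectC defectZl defect_unit // !scaler0.
have defect_sa x y : sa x -> sa y -> defect x y = 0.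
  move=> sa_x sa_y; apply: addrr_eq0; have := defect_sqr (x + y) (saD sa_x sa_y).
  rewrite defectDl !defectDr !defect_sqr // (defectC y x); move=> <-; nc_ring.
move=> x y; apply/eqP; rewrite -subr_eq0 -/(defect x y); apply/eqP; move: x.
apply: (linear_sa_eq0 (defectZl y) (defectDl y)) => x sa_x; rewrite defectC.
by apply: (linear_sa_eq0 (defectZl x) (defectDl x)) => {}y sa_y; apply: defect_sa.
Qed.

End Orthogonality.

(** * Bilinear forms of Leibniz type *)

Section LeibnizForm.
Context {R : realType} {A : cstarAlgType R}.
Implicit Types (a b c k x y : A) (F G H K T : {linear A -> A}).

(** Covers, by choosing the four maps, both the Jordan form
    T x y + x T y + y T x + T y x and the one-sided form T x y + x S y. *)
Definition leibniz_form F G H K x y := F x * y + x * G y + (y * H x + K y * x).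

Lemma leibniz_form_bilinear F G H K :
  bilinear_for *:%R *:%R (leibniz_form F G H K).
Proof.
split=> [y k a b|x k a b]; rewrite /leibniz_form !linearP /=.
  rewrite !mulrDl !mulrDr -!scalerAl -!scalerAr !scalerDr; nc_ring.
rewrite !mulrDl !mulrDr -!scalerAl -!scalerAr !scalerDr; nc_ring.
Qed.

HB.instance Definition _ F G H K :=
  bilinear_isBilinear.Build R[i] A A A *:%R *:%R (leibniz_form F G H K)
    (leibniz_form_bilinear F G H K).

Definition unit_bounded (F : A -> A) (C : R) := forall x, nrm x <= 1 -> nrm (F x) <= C.

Lemma leibniz_form_bounded F G H K C :
    unit_bounded F C -> unit_bounded G C -> unit_bounded H C -> unit_bounded K C ->
  forall x y, nrm x <= 1 -> nrm y <= 1 -> nrm (leibniz_form F G H K x y) <= C *+ 4.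
Proof.
move=> FC GC HC KC x y x_le1 y_le1.
have C_ge0 : 0 <= C by apply: le_trans (nrm_ge0 _) (FC 0 _); rewrite nrm0.
have boundl u v : nrm u <= C -> nrm v <= 1 -> nrm (u * v) <= C.
  move=> u_le v_le; apply: le_trans (nrmM _ _) _.
  by rewrite -[C]mulr1 ler_pM ?nrm_ge0.
have boundr u v : nrm u <= C -> nrm v <= 1 -> nrm (v * u) <= C.
  move=> u_le v_le; apply: le_trans (nrmM _ _) _.
  by rewrite -[C]mul1r ler_pM ?nrm_ge0.
have bound2 u v u' v' : nrm u <= C -> nrm v <= 1 -> nrm v' <= 1 -> nrm u' <= C ->
    nrm (u * v + v' * u') <= C *+ 2.
  move=> u_le v_le v'_le u'_le; apply: le_trans (nrmD _ _) _.
  by rewrite mulr2n; apply: lerD; [exact: boundl|exact: boundr].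
apply: le_trans (nrmD _ _) _; rewrite -[C *+ 4]/(C *+ (2 + 2)) mulrnDr.
by apply: lerD; [|rewrite addrC]; apply: bound2 => //; auto.
Qed.

Definition adjoint T x := star (T (star x)).

Lemma adjoint_linear T : linear (adjoint T).
Proof. by move=> k a b; rewrite /adjoint starD starZ linearP starD starZ conjCK. Qed.

HB.instance Definition _ T :=
  GRing.isLinear.Build R[i] A A *:%R (adjoint T) (adjoint_linear T).

(** Such a map kills interactions between orthogonal p and q: first
    p E q = E q p = 0, then, applying E again, E q E p = 0. So E(p + q) and
    E(p - q) have equal squares. With p, q = |k| + k, |k| - k this equates the
    norms of E |k| and E k; as E 1 = 0, the tent map k |-> 2 |k| - 1 doubles the
    norm of E k. *)
Lemma sa_skew_quasiderivation_eq0 (E : {linear A -> A}) (C : R) :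
    unit_bounded E C ->
    (forall k, sa k -> star (E k) = - E k) ->
    (forall x y, E (x * y + y * x) = (x * E y + y * E x) + (x * E y + y * E x)) ->
  forall x, E x = 0.
Proof.
move=> E_le E_skew E_mul.
have E1 : E 1 = 0.
  have := E_mul 1 1; rewrite !mul1r linearD => e.
  apply: addrr_eq0; apply: (addrI (E 1 + E 1)); rewrite addr0 -e //.
have orth p q : sa p -> sa q -> p * q = 0 -> p * E q = 0.
  move=> sa_p sa_q pq; have qp : q * p = 0 by rewrite -sa_p -sa_q -starM pq star0.
  have : p * E q + q * E p = 0.
    by apply: addrr_eq0; rewrite -E_mul pq qp addr0 linear0.
  move=> /(congr1 (fun u => p * u)); rewrite mulrDr [p * (q * _)]mulrA pq mul0r.
  (* Now p^2 z = 0 for z = E q, and the C*-identity removes one factor p. *)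
  rewrite addr0 mulr0 => ppz.
  by apply: starM_eq0; rewrite starM sa_p -mulrA ppz mulr0.
have orthr p q : sa p -> sa q -> p * q = 0 -> E q * p = 0.
  move=> sa_p sa_q pq; have := orth p q sa_p sa_q pq.
  by move=> /(congr1 star); rewrite starM E_skew // sa_p star0 mulNr => /eqP;
    rewrite oppr_eq0 => /eqP.
have orth_ranges p q : sa p -> sa q -> p * q = 0 -> E q * E p = 0.
  move=> sa_p sa_q pq.
  have pz := orth p q sa_p sa_q pq; have zp := orthr p q sa_p sa_q pq.
  have : p * E (E q) + E q * E p = 0.
    by apply: addrr_eq0; rewrite -E_mul pz zp addr0 linear0.
  (* Multiplying by z = E q leaves z^2 w = 0 for w = E p, and z^* = - z. *)
  move=> /(congr1 (fun u => E q * u)); rewrite mulrDr mulrA zp mul0r add0r mulr0 => zzw.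
  by apply: starM_eq0; rewrite starM !E_skew // mulrNN -mulrA zzw mulr0.
have E_abs a k : sa a -> sa k -> a * a = k * k -> a * k = k * a ->
    nrm (E a) = nrm (E k).
  move=> sa_a sa_k aa ak.
  have sa_p := saD sa_a sa_k; have sa_q := saB sa_a sa_k.
  have pq : (a + k) * (a - k) = 0 by rewrite mulrDl !mulrBr aa ak; nc_ring.
  have qp : (a - k) * (a + k) = 0 by rewrite mulrBl !mulrDr aa ak; nc_ring.
  have zw := orth_ranges _ _ sa_p sa_q pq; have wz := orth_ranges _ _ sa_q sa_p qp.
  have sqr : E a * E a = E k * E k.
    apply: addrr_inj; apply/eqP; rewrite -subr_eq0; apply/eqP.
    rewrite -[RHS]addr0 -{1}zw -wz !linearB !linearD /=; nc_ring.
  apply/eqP; rewrite -(@eqrXn2 _ 2) ?nrm_ge0 //.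
  by rewrite -!nrm_starM !E_skew // !mulNr sqr.
have E_unit k : sa k -> nrm k <= 1 -> E k = 0.
  move=> sa_k k_le1; apply: nrm_eq0; apply/eqP; rewrite eq_le nrm_ge0 andbT.
  move: k sa_k k_le1; apply: (@doubling_le0 _ _ (fun k => nrm (E k)) C).
    by move=> k _; apply: E_le.
  move=> k sa_k k_le1; have [a [sa_a aa ak m_le1]] := exists_abs sa_k k_le1.
  exists (a + a - 1); split=> //; first by apply: saB (saD sa_a sa_a) sa1.
  by rewrite linearB linearD /= E1 subr0 nrm_double (E_abs a k).
apply: linear_sa_eq0 => [k a|a b|a]; [exact: linearZ|exact: linearD|].
by move=> /sa_scale_unit [s [k [-> sa_k k_le1]]]; rewrite linearZ /= E_unit ?scaler0.
Qed.

End LeibnizForm.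

(** * Triple derivations at zero *)

Section TripleDerivations.
Context {R : realType} {A : cstarAlgType R}.
Implicit Types (a b c h k p q x y : A) (T D : {linear A -> A}).

Lemma tripleE a b c : triple a b c + triple a b c = a * star b * c + c * star b * a.
Proof.
rewrite /triple -scalerDl.
have -> : (2%:R : R[i])^-1 + 2%:R^-1 = 1 by field.
exact: scale1r.
Qed.

Lemma tripleDl a a' b c : triple (a + a') b c = triple a b c + triple a' b c.
Proof. rewrite /triple -scalerDr; congr (_ *: _); nc_ring. Qed.

Lemma tripleDm a b b' c : triple a (b + b') c = triple a b c + triple a b' c.
Proof. rewrite /triple -scalerDr starD; congr (_ *: _); nc_ring. Qed.

Lemma tripleDr a b c c' : triple a b (c + c') = triple a b c + triple a b c'.
Proof. rewrite /triple -scalerDr; congr (_ *: _); nc_ring. Qed.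

Lemma triple_eq0 a b c : a * star b * c + c * star b * a = 0 -> triple a b c = 0.
Proof. by rewrite -tripleE => /addrr_eq0. Qed.

(** Clearing the factor 1/2 leaves identities free of scalars. *)
Lemma triple_derivation_doubled T :
    (forall a b c, T (a * star b * c + c * star b * a)
       = (T a * star b * c + c * star b * T a) + (a * star (T b) * c + c * star (T b) * a)
         + (a * star b * T c + T c * star b * a)) ->
  triple_derivation T.
Proof.
by move=> Tabc a b c; rewrite /triple linearZ /= Tabc -!scalerDr.
Qed.

Lemma triple_at_zero_doubled T a b c :
    triple_derivation_at_zero T -> a * star b * c + c * star b * a = 0 ->
  (T a * star b * c + c * star b * T a) + (a * star (T b) * c + c * star (T b) * a)
    + (a * star b * T c + T c * star b * a) = 0.
Proof.
move=> T0 /triple_eq0/T0 e; rewrite -!tripleE.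
rewrite -[RHS]addr0 -{1}e -e; nc_ring.
Qed.

(** For skew h this is the inner triple derivation x |-> {h, 1, x} - {1, h, x},
    whose value at 1 is h. *)
Definition half_anticommutator h x := halve (h * x + x * h).

Lemma half_anticommutator_linear h : linear (half_anticommutator h).
Proof.
move=> k a b; rewrite /half_anticommutator /halve mulrDr mulrDl -scalerAl -scalerAr.
rewrite scalerA mulrC -scalerA -scalerDr; congr (_ *: _).
rewrite scalerDr; nc_ring.
Qed.

HB.instance Definition _ h :=
  GRing.isLinear.Build R[i] A A *:%R (half_anticommutator h)
    (half_anticommutator_linear h).

Lemma half_anticommutator_triple_derivation h :
  star h = - h -> triple_derivation (half_anticommutator h).
Proof.
move=> star_h; apply: triple_derivation_doubled => a b c.
have DE x : half_anticommutator h x + half_anticommutator h x = h * x + x * h.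
  exact: halveK.
have starDE x : star (half_anticommutator h x) + star (half_anticommutator h x)
    = - (star x * h) - h * star x.
  by rewrite -starD DE starD !starM star_h mulrN mulNr.
apply: addrr_inj; rewrite DE.
set Da := half_anticommutator h a in DE *; set Dc := half_anticommutator h c.
set Db := star (half_anticommutator h b).
transitivity (((Da + Da) * star b * c + c * star b * (Da + Da))
   + (a * (Db + Db) * c + c * (Db + Db) * a) + (a * star b * (Dc + Dc) + (Dc + Dc) * star b * a)).
  rewrite starDE !DE; nc_ring.
nc_ring.
Qed.

Lemma triple_derivationD T D1 D2 : (forall x, T x = D1 x + D2 x) ->
  triple_derivation D1 -> triple_derivation D2 -> triple_derivation T.
Proof.
move=> TE D1P D2P a b c; rewrite !TE D1P D2P.
by rewrite tripleDl tripleDm tripleDr; nc_ring.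
Qed.

(** In terms of the Jordan product J(x, y) = xy + yx and d = b^*,
    2 (a d c + c d a) = J(J(a, d), c) + J(J(c, d), a) - J(J(a, c), d). *)
Lemma jordan_star_triple_derivation T :
    (forall x, T (star x) = star (T x)) ->
    (forall x y, T (x * y + y * x) = T x * y + x * T y + (y * T x + T y * x)) ->
  triple_derivation T.
Proof.
move=> T_star T_jordan; apply: triple_derivation_doubled => a b c.
rewrite -T_star; set d := star b.
apply: addrr_inj; rewrite -linearD.
have -> : a * d * c + c * d * a + (a * d * c + c * d * a)
   = ((a * d + d * a) * c + c * (a * d + d * a)) + ((c * d + d * c) * a + a * (c * d + d * c))
     - ((a * c + c * a) * d + d * (a * c + c * a)) by nc_ring.
rewrite linearB linearD /= !T_jordan; nc_ring.
Qed.

Section UnitZero.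
Variables (T : {linear A -> A}) (C : R).
Hypothesis T_le : unit_bounded T C.
Hypothesis T_at_zero : triple_derivation_at_zero T.
Hypothesis T1 : T 1 = 0.

(** The condition at {p, 1, q} = 0, where the term in T 1 drops out. *)
Lemma jordan_at_orthogonal p q : sa p -> sa q -> p * q = 0 ->
  T p * q + p * T q + (q * T p + T q * p) = 0.
Proof.
move=> sa_p sa_q pq; have qp : q * p = 0 by rewrite -sa_p -sa_q -starM pq star0.
have := @triple_at_zero_doubled T p 1 q T_at_zero.
rewrite star1 !mulr1 pq qp addr0 T1 star0 => /(_ erefl) <-; nc_ring.
Qed.

Lemma jordan_derivation x y : T (x * y + y * x) = T x * y + x * T y + (y * T x + T y * x).
Proof.
have TC := leibniz_form_bounded T_le T_le T_le T_le.
have := bilinear_orthogonal TC jordan_at_orthogonal x y.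
rewrite /= /leibniz_form T1 !mulr1 !mul1r !mulr0 !mul0r !addr0 !add0r => e.
do 2 apply: addrr_inj; rewrite -e; nc_ring.
Qed.

(** The condition at {p, q, c} = 0 reads X c + c Y = 0 for all c, with X the left
    side of the claim; c = 1 gives Y = - X, so X is central. Multiplying by p and q
    shows X p = X q = 0, hence X^2 = 0, and a central X is normal. *)
Lemma leibniz_at_orthogonal p q : sa p -> sa q -> p * q = 0 ->
  T p * q + p * adjoint T q = 0.
Proof.
move=> sa_p sa_q pq; have qp : q * p = 0 by rewrite -sa_p -sa_q -starM pq star0.
rewrite /adjoint sa_q; set S := star (T q).
set X := T p * q + p * S; pose Y := q * T p + S * p.
have XY c : X * c + c * Y = 0.
  have pqc : p * star q * c + c * star q * p = 0.
    by rewrite sa_q pq -mulrA qp mulr0 mul0r addr0.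
  have := triple_at_zero_doubled T_at_zero pqc.
  rewrite sa_q pq -[T c * q * p]mulrA qp mulr0 mul0r !addr0 => <-.
  rewrite /X /Y -/S; nc_ring.
have Y_E : Y = - X.
  by have /eqP := XY 1; rewrite mulr1 mul1r addrC addr_eq0 => /eqP.
have X_central c : X * c = c * X.
  by have /eqP := XY c; rewrite Y_E mulrN subr_eq0 => /eqP.
have Xp : X * p = 0.
  have e1 : X * p = p * S * p by rewrite /X mulrDl -mulrA qp mulr0 add0r.
  have e2 : p * Y = p * S * p by rewrite /Y mulrDr !mulrA pq mul0r add0r.
  by apply: addrr_eq0; rewrite {1}e1 -e2 Y_E mulrN X_central addNr.
have Xq : X * q = 0.
  have e1 : q * X = q * T p * q by rewrite /X mulrDr !mulrA qp mul0r addr0.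
  have e2 : Y * q = q * T p * q by rewrite /Y mulrDl -!mulrA pq !mulr0 addr0 mulrA.
  by apply: addrr_eq0; rewrite {1}X_central e1 -e2 Y_E mulNr addNr.
have XX : X * X = 0.
  rewrite {2}/X mulrDr !mulrA Xp mul0r addr0 X_central.
  by rewrite -mulrA Xq mulr0.
apply: starM_eq0; apply: starM_eq0.
by rewrite starM starK -mulrA [X * _]mulrA X_central -mulrA XX !mulr0.
Qed.

Lemma adjoint_bounded : unit_bounded (adjoint T) C.
Proof. by move=> x x_le1; rewrite nrm_star T_le // nrm_star. Qed.

Lemma adjoint_jordan_derivation x y : adjoint T (x * y + y * x)
  = adjoint T x * y + x * adjoint T y + (y * adjoint T x + adjoint T y * x).
Proof.
rewrite /adjoint starD !starM addrC jordan_derivation !starD !starM !starK; nc_ring.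
Qed.

(** The difference E = T - S of T and its adjoint S is skew on self-adjoint
    elements; subtracting the Jordan identities of T and S from the identity for
    T x y + x S y shows that E satisfies the quasi-derivation rule. *)
Lemma adjoint_eq x : adjoint T x = T x.
Proof.
have C_ge0 : 0 <= C by apply: le_trans (nrm_ge0 _) (T_le (x := 0) _); rewrite nrm0.
have zero_bounded : unit_bounded (\0 : {linear A -> A}) C by move=> y _; rewrite /= nrm0.
pose V := leibniz_form T (adjoint T) \0 \0.
have VE a b : V a b = T a * b + a * adjoint T b.
  by rewrite /V /leibniz_form mulr0 mul0r !addr0.
have V_orth p q : sa p -> sa q -> p * q = 0 -> V p q = 0.
  by rewrite VE; apply: leibniz_at_orthogonal.
have S1 : adjoint T 1 = 0 by rewrite /adjoint star1 T1 star0.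
have VC := leibniz_form_bounded T_le adjoint_bounded zero_bounded zero_bounded.
pose E : {linear A -> A} := T \- adjoint T.
have EE a : E a = T a - adjoint T a by [].
have E_mul a b : E (a * b + b * a) = (a * E b + b * E a) + (a * E b + b * E a).
  rewrite !EE jordan_derivation adjoint_jordan_derivation.
  have := bilinear_orthogonal VC V_orth a b; rewrite /= -/V !VE.
  rewrite T1 S1 mulr1 mul1r mulr0 mul0r addr0 add0r jordan_derivation adjoint_jordan_derivation => e.
  apply/eqP; rewrite -subr_eq0; apply/eqP.
  move/eqP: e; rewrite -subr_eq0 => /eqP e.
  rewrite -[RHS]e; nc_ring.
have E_skew k : sa k -> star (E k) = - E k.
  by move=> sa_k; rewrite EE /adjoint sa_k starB starK opprB.
have E_le : unit_bounded E (C *+ 2).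
  move=> k k_le1; rewrite EE mulr2n; apply: le_trans (nrmB _ _) _.
  by apply: lerD; [exact: T_le|exact: adjoint_bounded].
have /eqP := sa_skew_quasiderivation_eq0 E_le E_skew E_mul x.
by rewrite EE subr_eq0 => /eqP.
Qed.

Lemma triple_derivation_of_unit_zero : triple_derivation T.
Proof.
apply: jordan_star_triple_derivation jordan_derivation => x.
by rewrite -(adjoint_eq (star x)) /adjoint starK.
Qed.

End UnitZero.

End TripleDerivations.

Theorem corollary2p11 (R : realType) (A : cstarAlgType R) (T : {linear A -> A})
    (T_bounded : bounded_operator T)
    (T_at_zero : triple_derivation_at_zero T)
    (T1_skew : star (T 1) = - T 1) :
  triple_derivation T.
Proof.
have D_triple := half_anticommutator_triple_derivation T1_skew.
set D : {linear A -> A} := half_anticommutator (T 1) in D_triple.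
pose T' : {linear A -> A} := T \- D.
have TE x : T x = T' x + D x by rewrite /T' /= subrK.
have T'1 : T' 1 = 0.
  by rewrite /T' /= /half_anticommutator mulr1 mul1r halve_double subrr.
apply: (triple_derivationD TE _ D_triple).
have [M TM] := T_bounded.
have T_le x : nrm x <= 1 -> nrm (T x) <= `|M|.
  move=> x_le1; have : nrm (T x) <= M * nrm x by rewrite -lecR rmorphM /= -!nrmE.
  move=> /le_trans; apply; apply: le_trans (ler_norm _) _.
  by rewrite normrM (ger0_norm (nrm_ge0 x)) ler_piMr.
have D_le x : nrm x <= 1 -> nrm (D x) <= nrm (T 1).
  move=> x_le1; rewrite -(@ler_pMn2r _ 2) // -nrm_double.
  rewrite [D x + D x]halveK mulr2n; apply: le_trans (nrmD _ _) _.
  apply: lerD; apply: le_trans (nrmM _ _) _; first by rewrite ler_piMr ?nrm_ge0.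
  by rewrite ler_piMl ?nrm_ge0.
apply: (@triple_derivation_of_unit_zero _ _ _ (`|M| + nrm (T 1))) => // [x x_le1|a b c abc].
  rewrite /T' /=; apply: le_trans (nrmB _ _) _; apply: lerD; [exact: T_le|exact: D_le].
have := T_at_zero a b c abc; have := D_triple a b c; rewrite abc linear0 => D0.
rewrite !TE tripleDl tripleDm tripleDr => <-.
rewrite -[LHS]addr0 D0; nc_ring.
Qed.
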